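(* For any distinct numbers $n,m\in\omega$, there is no $e$-degree which is both an $(\omega^\omega)_{GH(n)}$-degree and an $(\omega^\omega)_{GH(m)}$-degree.
   Context: Enumeration reducibility: for $A,B\subseteq\omega$, $A\leq_e B$ iff there is a c.e. set $\Phi$ such that $n\in A\iff(\exists e)[\langle n,e\rangle\in\Phi$ and $D_e\subseteq B]$, where $(D_e)$ is a computable enumeration of all finite subsets of $\omega$. The equivalence classes of $\equiv_e$ are the $e$-degrees. Let $S^n_e$ be the $e$-th (lightface) $\Sigma^1_n$ subset of $\omega^\omega$ in a standard effective parametrization of $\Sigma^1_n$. $(\omega^\omega)_{GH(n)}$ denotes $\omega^\omega$ with the $\Sigma^1_n$-Gandy-Harrington topology, generated by the subbasis $(S^n_e)_{e\in\omega}$ of all $\Sigma^1_n$ subsets of $\omega^\omega$. For $x\in(\omega^\omega)_{GH(n)}$, the coded neighborhood filter is $\{e\in\omega:x\in S^n_e\}$. An $e$-degree is an $(\omega^\omega)_{GH(n)}$-degree if it contains $\{e\in\omega:x\in S^n_e\}$ for some $x\in\omega^\omega$. *)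

(* Defs.v *)
From Stdlib Require Import Arith List Cantor.

Definition natset := nat -> Prop.
Definition baire := nat -> nat.

Definition cpair (a b : nat) : nat := Cantor.to_nat (a, b).
Arguments cpair : simpl never.
Definition pi1 (n : nat) : nat := fst (Cantor.of_nat n).
Definition pi2 (n : nat) : nat := snd (Cantor.of_nat n).

(** * Partial recursive functions and c.e. sets *)

(* Unary partial recursive functions; several arguments are passed through
   the Cantor pairing bijection. *)
Inductive prog : Type :=
| PZero | PSucc | PLeft | PRight
| PPair (f g : prog)
| PComp (f g : prog)
| PRec (f g : prog)
| PMu (f : prog).

(* [eval c n v]: the partial function computed by [c] is defined at [n] with
   value [v].
   PRec f g is h with h(a,0) = f(a) and h(a,k+1) = g(a,(k,h(a,k))); the
   witness [h] below lists h(a,0), ..., h(a,k).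
   PMu f is a |-> the least v with f(a,v) = 0, where f(a,i) must be defined
   for all i < v. *)
Fixpoint eval (c : prog) (n v : nat) : Prop :=
  match c with
  | PZero => v = 0
  | PSucc => v = S n
  | PLeft => v = pi1 n
  | PRight => v = pi2 n
  | PPair f g => exists a b, eval f n a /\ eval g n b /\ v = cpair a b
  | PComp f g => exists u, eval g n u /\ eval f u v
  | PRec f g =>
      exists h : nat -> nat,
        eval f (pi1 n) (h 0) /\
        (forall i, i < pi2 n ->
           eval g (cpair (pi1 n) (cpair i (h i))) (h (S i))) /\
        v = h (pi2 n)
  | PMu f =>
      eval f (cpair n v) 0 /\
      (forall i, i < v -> exists u, eval f (cpair n i) (S u))
  end.

Definition ce (A : natset) : Prop :=
  exists c : prog, forall n, A n <-> exists v, eval c n v.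

(** * Enumeration reducibility and e-degrees *)

(* Canonical indices: D_e is the set of positions of the digits 1 in the
   binary expansion of e. *)
Definition D (e : nat) : natset := fun i => Nat.testbit e i = true.

Definition le_e (A B : natset) : Prop :=
  exists Phi : natset, ce Phi /\
    forall n, A n <-> exists e, Phi (cpair n e) /\ forall i, D e i -> B i.

Definition equiv_e (A B : natset) : Prop := le_e A B /\ le_e B A.

Definition e_degree (d : natset -> Prop) : Prop :=
  exists A : natset, forall B : natset, d B <-> equiv_e B A.

(** * Arithmetical formulas with function variables *)

(* Number variables and function variables are de Bruijn indices into two
   separate environments; [TApp f t] is the value of function variable [f]
   at [t]. Only number variables are quantified here. *)
Inductive term : Type :=
| TVar (i : nat)
| TZero
| TSucc (t : term)
| TAdd (s t : term)
| TMul (s t : term)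
| TApp (f : nat) (t : term).

Inductive form : Type :=
| FEq (s t : term)
| FNot (p : form)
| FAnd (p q : form)
| FEx (p : form).

(* Indices beyond the end of an environment denote 0, resp. the constant
   function 0. *)
Fixpoint tval (rho : list baire) (env : list nat) (t : term) : nat :=
  match t with
  | TVar i => nth i env 0
  | TZero => 0
  | TSucc t => S (tval rho env t)
  | TAdd s t => tval rho env s + tval rho env t
  | TMul s t => tval rho env s * tval rho env t
  | TApp f t => nth f rho (fun _ => 0) (tval rho env t)
  end.

Fixpoint sat (rho : list baire) (env : list nat) (p : form) : Prop :=
  match p with
  | FEq s t => tval rho env s = tval rho env t
  | FNot p => ~ sat rho env p
  | FAnd p q => sat rho env p /\ sat rho env q
  | FEx p => exists a, sat rho (a :: env) p
  end.

Fixpoint tcode (t : term) : nat :=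
  match t with
  | TVar i => cpair 0 i
  | TZero => cpair 1 0
  | TSucc t => cpair 2 (tcode t)
  | TAdd s t => cpair 3 (cpair (tcode s) (tcode t))
  | TMul s t => cpair 4 (cpair (tcode s) (tcode t))
  | TApp f t => cpair 5 (cpair f (tcode t))
  end.

Fixpoint fcode (p : form) : nat :=
  match p with
  | FEq s t => cpair 0 (cpair (tcode s) (tcode t))
  | FNot p => cpair 1 (fcode p)
  | FAnd p q => cpair 2 (cpair (fcode p) (fcode q))
  | FEx p => cpair 3 (fcode p)
  end.

Lemma pair_inj a b a' b' : cpair a b = cpair a' b' -> a = a' /\ b = b'.
Proof.
  intro H; apply (f_equal Cantor.of_nat) in H; unfold cpair in H.
  rewrite !Cantor.cancel_of_to in H; now inversion H.
Qed.

Ltac code_inj :=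
  repeat match goal with
  | H : cpair _ _ = cpair _ _ |- _ => apply pair_inj in H; destruct H
  end.

Lemma tcode_inj s t : tcode s = tcode t -> s = t.
Proof.
  revert t; induction s; intros [] H; cbn in H; code_inj;
    try discriminate; f_equal; auto.
Qed.

Lemma fcode_inj p q : fcode p = fcode q -> p = q.
Proof.
  revert q; induction p; intros [] H; cbn in H; code_inj;
    try discriminate; f_equal; auto using tcode_inj.
Qed.

(** * Lightface Sigma^1_n sets *)

(* [prenex true n p rho]  : exists y1, forall y2, exists y3, ..., p
   [prenex false n p rho] : forall y1, exists y2, forall y3, ..., p
   with n alternating function quantifiers in front of the arithmetical
   matrix [p]. Each quantifier pushes its variable in front of [rho]. For
   n = 0 these are the arithmetical relations (Sigma^1_0 = Pi^1_0). *)
Fixpoint prenex (b : bool) (n : nat) (p : form) (rho : list baire) : Prop :=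
  match n with
  | 0 => sat rho nil p
  | S n =>
      if b then exists y : baire, prenex false n p (y :: rho)
      else forall y : baire, prenex true n p (y :: rho)
  end.

(* S^n_e: the set defined by the Sigma^1_n formula whose matrix has Goedel
   number e; it is empty if e is not a Goedel number. *)
Definition Sigma1 (n e : nat) (x : baire) : Prop :=
  exists p : form, fcode p = e /\ prenex true n p (x :: nil).

Definition nbhd_filter (n : nat) (x : baire) : natset := fun e => Sigma1 n e x.

Definition GH_degree (n : nat) (d : natset -> Prop) : Prop :=
  e_degree d /\ exists x : baire, d (nbhd_filter n x).

(* Main.v *)
(* Let n < m and suppose that the set A of Sigma^1_n-codes true of x and the set B
   of Sigma^1_m-codes true of y are e-equivalent. Codes of atomic formulas make the
   graph of x e-reducible to A, hence to B, so the condition x' = x on x' is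
   Sigma^1_m in y. Since B is e-reducible to A, its complement is
   { e | exists x', x' = x and e is not in Phi(A(x')) }, and A(x') is Pi^1_m because
   n < m. Thus the complement of B is Sigma^1_m(y), against diagonalization.

   The truth sets are placed in the hierarchy by Tarski's clauses: a predicate on
   numbers that is the unique solution of a well-founded recursion can be quantified
   either existentially or universally, hence is Delta^1_1. The same principle
   replaces Goedel's beta function for primitive recursion. *)
From Stdlib Require Import Arith Lia Cantor List Classical ClassicalEpsilon FunctionalExtensionality.
Require Import Defs.

(** * The Cantor pairing function *)

Lemma pi1_cpair a b : pi1 (cpair a b) = a.
Proof. unfold pi1, cpair; now rewrite Cantor.cancel_of_to. Qed.

Lemma pi2_cpair a b : pi2 (cpair a b) = b.
Proof. unfold pi2, cpair; now rewrite Cantor.cancel_of_to. Qed.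

Lemma cpair_pi n : cpair (pi1 n) (pi2 n) = n.
Proof.
  unfold pi1, pi2, cpair; rewrite <- surjective_pairing; apply Cantor.cancel_to_of.
Qed.

(** Doubling clears the division in the Cantor pairing, so its graph is a polynomial equation. Both
    the size bounds and the arithmetical definition of pairing rest on this form. *)
Lemma cpair_eqn n a b : n = cpair a b <-> n * 2 = b * 2 + (b + a) * S (b + a).
Proof. unfold cpair; pose proof (Cantor.to_nat_spec a b); lia. Qed.

Lemma cpair_le_r a b : b <= cpair a b.
Proof. pose proof (proj1 (cpair_eqn _ a b) eq_refl); nia. Qed.

(** A nonzero tag makes a code larger than its content. Together with [cpair_lt_pair] this lets
    recursions on syntax codes descend. *)
Lemma cpair_lt_r a b : b < cpair (S a) b.
Proof. pose proof (proj1 (cpair_eqn _ (S a) b) eq_refl); nia. Qed.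

Lemma cpair_le_l a b : a <= cpair a b.
Proof. pose proof (proj1 (cpair_eqn _ a b) eq_refl); nia. Qed.

Lemma cpair_lt_pair a r r' :
  r < cpair (S a) (cpair r r') /\ r' < cpair (S a) (cpair r r').
Proof.
  pose proof (cpair_lt_r a (cpair r r')).
  pose proof (cpair_le_l r r'); pose proof (cpair_le_r r r'); lia.
Qed.

(** Needed for variables, whose tag is 0: the recursion passes from variable [S i] to variable
    [i]. *)
Lemma cpair_lt_mono_r a b c : b < c -> cpair a b < cpair a c.
Proof.
  intro H; pose proof (proj1 (cpair_eqn _ a b) eq_refl).
  pose proof (proj1 (cpair_eqn _ a c) eq_refl); nia.
Qed.

(** * Arithmetical relations *)

Definition scons {A} (a : A) (s : nat -> A) : nat -> A :=
  fun i => match i with 0 => a | S i => s i end.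

(** Environments become total sequences here, so that renaming is composition with a map and list
    lengths do not matter. *)
Fixpoint ftval (rho : nat -> baire) (s : nat -> nat) (t : term) : nat :=
  match t with
  | TVar i => s i
  | TZero => 0
  | TSucc t => S (ftval rho s t)
  | TAdd t u => ftval rho s t + ftval rho s u
  | TMul t u => ftval rho s t * ftval rho s u
  | TApp f t => rho f (ftval rho s t)
  end.

Fixpoint fsat (rho : nat -> baire) (s : nat -> nat) (p : form) : Prop :=
  match p with
  | FEq t u => ftval rho s t = ftval rho s u
  | FNot p => ~ fsat rho s p
  | FAnd p q => fsat rho s p /\ fsat rho s q
  | FEx p => exists a, fsat rho (scons a s) p
  end.

Definition zero : baire := fun _ => 0.
Definition flist (rho : list baire) : nat -> baire := fun i => nth i rho zero.
Definition nlist (env : list nat) : nat -> nat := fun i => nth i env 0.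

Lemma tval_ftval rho env t : tval rho env t = ftval (flist rho) (nlist env) t.
Proof. induction t; cbn; rewrite ?IHt, ?IHt1, ?IHt2; reflexivity. Qed.

Lemma nlist_cons a env : nlist (a :: env) = scons a (nlist env).
Proof. apply functional_extensionality; now intros []. Qed.

Lemma sat_fsat rho p : forall env, sat rho env p <-> fsat (flist rho) (nlist env) p.
Proof.
  induction p; intro env; cbn.
  - now rewrite !tval_ftval.
  - now rewrite IHp.
  - now rewrite IHp1, IHp2.
  - split; intros [a H]; exists a; revert H; now rewrite IHp, nlist_cons.
Qed.

Fixpoint tren (r : nat -> nat) (t : term) : term :=
  match t with
  | TVar i => TVar (r i)
  | TZero => TZero
  | TSucc t => TSucc (tren r t)
  | TAdd t u => TAdd (tren r t) (tren r u)
  | TMul t u => TMul (tren r t) (tren r u)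
  | TApp f t => TApp f (tren r t)
  end.

Definition rup (r : nat -> nat) : nat -> nat := scons 0 (fun i => S (r i)).

Fixpoint fren (r : nat -> nat) (p : form) : form :=
  match p with
  | FEq t u => FEq (tren r t) (tren r u)
  | FNot p => FNot (fren r p)
  | FAnd p q => FAnd (fren r p) (fren r q)
  | FEx p => FEx (fren (rup r) p)
  end.

Lemma ftval_tren rho t r s : ftval rho s (tren r t) = ftval rho (fun i => s (r i)) t.
Proof. induction t; cbn; auto. Qed.

Lemma fsat_fren rho p : forall r e,
  fsat rho e (fren r p) <-> fsat rho (fun i => e (r i)) p.
Proof.
  induction p; intros r e; cbn.
  - now rewrite !ftval_tren.
  - now rewrite IHp.
  - now rewrite IHp1, IHp2.
  - assert (E : forall a, (fun i => scons a e (rup r i)) = scons a (fun i => e (r i)))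
      by (intro a; apply functional_extensionality; now intros []).
    split; intros [a H]; exists a; revert H; now rewrite IHp, E.
Qed.

(** Definability is stated for relations instead of formulas; closure lemmas then assemble one
    defining formula, uniform in both environments. *)
Definition DR (R : (nat -> baire) -> (nat -> nat) -> Prop) : Prop :=
  exists p, forall rho s, fsat rho s p <-> R rho s.

(* The graph of [F]; variable 0 holds the value. *)
Definition DF (F : (nat -> baire) -> (nat -> nat) -> nat) : Prop :=
  DR (fun rho s => s 0 = F rho (fun i => s (S i))).

Lemma DR_ext R R' : (forall rho s, R rho s <-> R' rho s) -> DR R -> DR R'.
Proof. intros H [p Hp]; exists p; intros; now rewrite Hp. Qed.

Lemma DR_not R : DR R -> DR (fun rho s => ~ R rho s).
Proof. intros [p Hp]; exists (FNot p); intros; cbn; now rewrite Hp. Qed.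

Lemma DR_and R R' : DR R -> DR R' -> DR (fun rho s => R rho s /\ R' rho s).
Proof. intros [p Hp] [q Hq]; exists (FAnd p q); intros; cbn; now rewrite Hp, Hq. Qed.

Lemma DR_ex R : DR R -> DR (fun rho s => exists a, R rho (scons a s)).
Proof.
  intros [p Hp]; exists (FEx p); intros; cbn; split; intros [a H]; exists a; now apply Hp.
Qed.

Lemma DR_term t u : DR (fun rho s => ftval rho s t = ftval rho s u).
Proof. now exists (FEq t u). Qed.

Lemma DR_ren R r : DR R -> DR (fun rho s => R rho (fun i => s (r i))).
Proof. intros [p Hp]; exists (fren r p); intros; now rewrite fsat_fren. Qed.

(** The term language need not have a symbol for [F]: its value is named by a quantified number that
    the graph of [F] determines. *)
Lemma DR_sub R F :
  DR (fun rho s => R rho (s 0) (fun i => s (S i))) -> DF F ->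
  DR (fun rho s => R rho (F rho s) s).
Proof.
  intros HR HF; eapply DR_ext; [|exact (DR_ex _ (DR_and _ _ HF HR))]; cbn.
  intros rho s; split.
  - intros [a [-> H]]; exact H.
  - intro H; exists (F rho s); split; [reflexivity | exact H].
Qed.

Lemma DF_shift F : DF F -> DF (fun rho s => F rho (fun i => s (S i))).
Proof. exact (DR_ren _ (scons 0 (fun i => S (S i)))). Qed.

Lemma DF_var i : DF (fun _ s => s i).
Proof. exact (DR_term (TVar 0) (TVar (S i))). Qed.

Lemma DF_comp G F :
  DF (fun rho s => G rho (fun i => s (S i)) (s 0)) -> DF F ->
  DF (fun rho s => G rho s (F rho s)).
Proof.
  intros HG HF; unfold DF.
  apply (DR_sub (fun rho a s => s 0 = G rho (fun i => s (S i)) a)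
                (fun rho s => F rho (fun i => s (S i)))).
  - exact (DR_ren _ (scons 1 (scons 0 (fun i => S (S i)))) HG).
  - now apply DF_shift.
Qed.

Lemma DF_map2 h F G :
  DR (fun _ s => s 0 = h (s 1) (s 2)) -> DF F -> DF G ->
  DF (fun rho s => h (F rho s) (G rho s)).
Proof.
  intros Hh HF HG.
  apply (DF_comp (fun rho s a => h a (G rho s)) F); [|exact HF].
  apply (DF_comp (fun rho s a => h (s 0) a) (fun rho s => G rho (fun i => s (S i))));
    [|now apply DF_shift].
  exact (DR_ren _ (scons 0 (scons 2 (fun _ => 1))) Hh).
Qed.

Lemma DF_map1 h F :
  DR (fun _ s => s 0 = h (s 1)) -> DF F -> DF (fun rho s => h (F rho s)).
Proof. intros Hh HF; exact (DF_map2 (fun a _ => h a) F F Hh HF HF). Qed.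

Lemma DF_zero : DF (fun _ _ => 0).
Proof. exact (DR_term (TVar 0) TZero). Qed.

Lemma DF_succ F : DF F -> DF (fun rho s => S (F rho s)).
Proof. apply DF_map1; exact (DR_term (TVar 0) (TSucc (TVar 1))). Qed.

Lemma DF_const n : DF (fun _ _ => n).
Proof. induction n; [exact DF_zero | exact (DF_succ _ IHn)]. Qed.

Lemma DF_add F G : DF F -> DF G -> DF (fun rho s => F rho s + G rho s).
Proof. apply DF_map2; exact (DR_term (TVar 0) (TAdd (TVar 1) (TVar 2))). Qed.

Lemma DF_mul F G : DF F -> DF G -> DF (fun rho s => F rho s * G rho s).
Proof. apply DF_map2; exact (DR_term (TVar 0) (TMul (TVar 1) (TVar 2))). Qed.

Lemma DR_cpair : DR (fun _ s => s 0 = cpair (s 1) (s 2)).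
Proof.
  apply (DR_ext (fun _ s => s 0 + s 0 =
    (s 2 + s 2) + (s 2 + s 1) * S (s 2 + s 1))).
  - intros; rewrite cpair_eqn; lia.
  - exact (DR_term (TAdd (TVar 0) (TVar 0))
      (TAdd (TAdd (TVar 2) (TVar 2))
            (TMul (TAdd (TVar 2) (TVar 1)) (TSucc (TAdd (TVar 2) (TVar 1)))))).
Qed.

Lemma DF_cpair F G : DF F -> DF G -> DF (fun rho s => cpair (F rho s) (G rho s)).
Proof. apply DF_map2, DR_cpair. Qed.

Lemma DF_pi1 F : DF F -> DF (fun rho s => pi1 (F rho s)).
Proof.
  apply DF_map1.
  eapply DR_ext; [|exact (DR_ex _ (DR_ren _ (scons 2 (scons 1 (fun _ => 0))) DR_cpair))].
  cbn; intros _ s; split.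
  - intros [a ->]; now rewrite pi1_cpair.
  - intros ->; exists (pi2 (s 1)); now rewrite cpair_pi.
Qed.

Lemma DF_pi2 F : DF F -> DF (fun rho s => pi2 (F rho s)).
Proof.
  apply DF_map1.
  eapply DR_ext; [|exact (DR_ex _ (DR_ren _ (scons 2 (scons 0 (fun _ => 1))) DR_cpair))].
  cbn; intros _ s; split.
  - intros [a ->]; now rewrite pi2_cpair.
  - intros ->; exists (pi1 (s 1)); now rewrite cpair_pi.
Qed.

Lemma DF_app f F : DF F -> DF (fun rho s => rho f (F rho s)).
Proof.
  apply (DF_comp (fun rho _ a => rho f a)); exact (DR_term (TVar 0) (TApp f (TVar 1))).
Qed.

Lemma DR_eq F G : DF F -> DF G -> DR (fun rho s => F rho s = G rho s).
Proof. intros HF HG; apply (DR_sub (fun rho a s => a = G rho s)); assumption. Qed.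

(** [G i] is substituted for function variable [i]. In the hypothesis its argument is variable 0,
    and the number parameters are shifted up by one. *)
Lemma DF_ftval_sub G t :
  (forall i, DF (fun rho s => G i rho (fun j => s (S j)) (s 0))) ->
  DF (fun rho s => ftval (fun i => G i rho s) s t).
Proof.
  intro HG; induction t; cbn.
  - apply DF_var.
  - apply DF_zero.
  - now apply DF_succ.
  - now apply DF_add.
  - now apply DF_mul.
  - now apply (DF_comp (fun rho s a => G f rho s a)).
Qed.

Lemma DR_fsat_sub p : forall G,
  (forall i, DF (fun rho s => G i rho (fun j => s (S j)) (s 0))) ->
  DR (fun rho s => fsat (fun i => G i rho s) s p).
Proof.
  induction p; intros G HG; cbn.
  - apply DR_eq; now apply DF_ftval_sub.
  - apply DR_not; auto.
  - apply DR_and; auto.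
  - apply (DR_ex (fun rho s => fsat (fun i => G i rho (fun j => s (S j))) s p)).
    apply (IHp (fun i rho s => G i rho (fun j => s (S j)))); intro i.
    (* Variable 0 is the value, 1 the argument and 2 the newly bound number, on which [G] does not
       depend. *)
    exact (DR_ren _ (scons 0 (scons 1 (fun j => S (S (S j))))) (HG i)).
Qed.

Lemma DR_sub_fun (R : baire -> (nat -> nat) -> Prop) G :
  DR (fun rho s => R (rho 0) s) ->
  DF (fun rho s => G rho (fun i => s (S i)) (s 0)) ->
  DR (fun rho s => R (G rho s) s).
Proof.
  intros [p Hp] HG.
  (* [R] reads function variable 0 alone, so all the others may be sent to [zero]. *)
  pose (G' := fun i rho s => match i with 0 => G rho s | S _ => zero end).
  eapply DR_ext; [|apply (DR_fsat_sub p G')].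
  - intros rho s; exact (Hp (fun i => G' i rho s) s).
  - intros []; [exact HG | apply DF_zero].
Qed.

(** * Relations on a single function *)

(** Functions are packed pointwise into one, numbers enter as constant functions and sequences of
    functions through [slice]. Hence the hierarchy is needed only for predicates of a single
    function. *)
Definition pr1 (z : baire) : baire := fun i => pi1 (z i).
Definition pr2 (z : baire) : baire := fun i => pi2 (z i).
Definition join (x y : baire) : baire := fun i => cpair (x i) (y i).
Definition num (n : nat) : baire := fun _ => n.
Definition slice (z : baire) (i : nat) : baire := fun j => z (cpair i j).

Lemma pr1_join x y : pr1 (join x y) = x.
Proof. apply functional_extensionality; intro; apply pi1_cpair. Qed.

Lemma pr2_join x y : pr2 (join x y) = y.
Proof. apply functional_extensionality; intro; apply pi2_cpair. Qed.

Lemma join_pr z : join (pr1 z) (pr2 z) = z.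
Proof. apply functional_extensionality; intro; apply cpair_pi. Qed.

Lemma slice_join (f : nat -> baire) i : slice (fun k => f (pi1 k) (pi2 k)) i = f i.
Proof.
  apply functional_extensionality; intro j; unfold slice; now rewrite pi1_cpair, pi2_cpair.
Qed.

Definition Ar (R : baire -> Prop) : Prop := DR (fun rho _ => R (rho 0)).
Definition NF (N : baire -> nat) : Prop := DF (fun rho _ => N (rho 0)).
Definition Op (G : baire -> baire) : Prop := DF (fun rho s => G (rho 0) (s 0)).

Lemma NF_const n : NF (fun _ => n).
Proof. exact (DF_const n). Qed.
Lemma NF_succ N : NF N -> NF (fun x => S (N x)).
Proof. unfold NF, Op in *; cbv beta; intros; apply DF_succ; assumption. Qed.
Lemma NF_add N M : NF N -> NF M -> NF (fun x => N x + M x).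
Proof. unfold NF, Op in *; cbv beta; intros; apply DF_add; assumption. Qed.
Lemma NF_mul N M : NF N -> NF M -> NF (fun x => N x * M x).
Proof. unfold NF, Op in *; cbv beta; intros; apply DF_mul; assumption. Qed.
Lemma NF_cpair N M : NF N -> NF M -> NF (fun x => cpair (N x) (M x)).
Proof. unfold NF, Op in *; cbv beta; intros; apply DF_cpair; assumption. Qed.
Lemma NF_pi1 N : NF N -> NF (fun x => pi1 (N x)).
Proof. unfold NF, Op in *; cbv beta; intros; apply DF_pi1; assumption. Qed.
Lemma NF_pi2 N : NF N -> NF (fun x => pi2 (N x)).
Proof. unfold NF, Op in *; cbv beta; intros; apply DF_pi2; assumption. Qed.
Lemma NF_app G N : Op G -> NF N -> NF (fun x => G x (N x)).
Proof. apply (DF_comp (fun rho _ a => G (rho 0) a)). Qed.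

Lemma Op_id : Op (fun x => x).
Proof. apply DF_app, DF_var. Qed.
Lemma Op_num N : NF N -> Op (fun x => num (N x)).
Proof. exact (fun H => H). Qed.
Lemma Op_pr1 G : Op G -> Op (fun x => pr1 (G x)).
Proof. unfold NF, Op in *; cbv beta; intros; apply DF_pi1; assumption. Qed.
Lemma Op_pr2 G : Op G -> Op (fun x => pr2 (G x)).
Proof. unfold NF, Op in *; cbv beta; intros; apply DF_pi2; assumption. Qed.
Lemma Op_join G H : Op G -> Op H -> Op (fun x => join (G x) (H x)).
Proof. unfold NF, Op in *; cbv beta; intros; apply DF_cpair; assumption. Qed.
Lemma Op_slice G N : Op G -> NF N -> Op (fun x => slice (G x) (N x)).
Proof.
  intros HG HN; apply (DF_comp (fun rho _ a => G (rho 0) a)); [exact HG|].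
  apply DF_cpair; [exact HN | apply DF_var].
Qed.
Lemma Op_comp G H : Op G -> Op H -> Op (fun x => G (H x)).
Proof.
  intros HG HH.
  exact (DR_sub_fun (fun x s => s 0 = G x (s 1)) (fun rho _ => H (rho 0)) HG HH).
Qed.

Lemma NF_comp N G : NF N -> Op G -> NF (fun x => N (G x)).
Proof.
  intros HN HG.
  exact (DR_sub_fun (fun x s => s 0 = N x) (fun rho _ => G (rho 0)) HN HG).
Qed.

(** Reads a definability proof off the syntax of the body; unknown symbols are settled by
    hypotheses. *)
Ltac definable :=
  lazymatch goal with
  | |- Op (fun x => x) => apply Op_id
  | |- Op pr1 => apply (Op_pr1 (fun x => x)), Op_id
  | |- Op pr2 => apply (Op_pr2 (fun x => x)), Op_id
  | |- Op (fun x => num _) => apply Op_num; definable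
  | |- Op (fun x => pr1 _) => apply Op_pr1; definable
  | |- Op (fun x => pr2 _) => apply Op_pr2; definable
  | |- Op (fun x => join _ _) => apply Op_join; definable
  | |- Op (fun x => slice _ _) => apply Op_slice; definable
  | |- Op (fun x => ?G (@?H x)) =>
      first [assumption | apply (Op_comp G H); [assumption | definable]]
  | |- Op _ => assumption
  | |- NF (fun x => S _) => apply NF_succ; definable
  | |- NF (fun x => _ + _) => apply NF_add; definable
  | |- NF (fun x => _ * _) => apply NF_mul; definable
  | |- NF (fun x => cpair _ _) => apply NF_cpair; definable
  | |- NF (fun x => pi1 _) => apply NF_pi1; definable
  | |- NF (fun x => pi2 _) => apply NF_pi2; definable
  | |- NF (fun x => x (@?N x)) => apply (NF_app (fun x => x) N); definable
  | |- NF (fun x => pr1 (@?G x) (@?N x)) => apply (NF_app (fun x => pr1 (G x)) N); definable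
  | |- NF (fun x => pr2 (@?G x) (@?N x)) => apply (NF_app (fun x => pr2 (G x)) N); definable
  | |- NF (fun x => ?N (@?G x)) =>
      first [assumption | apply (NF_comp N G); [assumption | definable]]
  | |- NF _ => first [assumption | apply NF_const]
  end.

Lemma Ar_ext R R' : (forall x, R x <-> R' x) -> Ar R -> Ar R'.
Proof. intro H; apply DR_ext; intros; apply H. Qed.

Lemma Ar_sub R (G : (nat -> baire) -> (nat -> nat) -> baire) :
  Ar R -> DF (fun rho s => G rho (fun i => s (S i)) (s 0)) ->
  DR (fun rho s => R (G rho s)).
Proof. exact (DR_sub_fun (fun x _ => R x) G). Qed.

Lemma Ar_not R : Ar R -> Ar (fun x => ~ R x).
Proof. exact (DR_not (fun rho _ => R (rho 0))). Qed.

Lemma Ar_ex R : Ar R -> Ar (fun x => exists i, R (join x (num i))).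
Proof.
  intro HR; apply (DR_ex (fun rho s => R (join (rho 0) (num (s 0))))).
  apply (Ar_sub R (fun rho s => join (rho 0) (num (s 0))) HR).
  apply DF_cpair; [apply DF_app, DF_var | apply DF_var].
Qed.

(** * The analytical hierarchy *)

(* Sigma^1_k for [b = true] and Pi^1_k for [b = false]. *)
Fixpoint Cls (b : bool) (k : nat) (R : baire -> Prop) : Prop :=
  match k with
  | 0 => Ar R
  | S k => exists R', Cls (negb b) k R' /\
      forall x, R x <-> if b then exists y, R' (join x y) else forall y, R' (join x y)
  end.

Lemma Cls_ext b k R R' : (forall x, R x <-> R' x) -> Cls b k R -> Cls b k R'.
Proof.
  destruct k; cbn; [apply Ar_ext|].
  intros H [Q [HQ HR]]; exists Q; split; [exact HQ|]; intro x; now rewrite <- H.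
Qed.

Lemma Cls_sub k : forall b R G, Cls b k R -> Op G -> Cls b k (fun x => R (G x)).
Proof.
  induction k; intros b R G HR HG; cbn in *.
  - now apply (Ar_sub R (fun rho _ => G (rho 0))).
  - destruct HR as [Q [HQ HR]].
    exists (fun z => Q (join (G (pr1 z)) (pr2 z))); split.
    + apply (IHk _ Q (fun z => join (G (pr1 z)) (pr2 z)) HQ); definable.
    + intro x; rewrite HR; destruct b; split.
      all: try (intros [y H]; exists y).
      all: try (intros H y; specialize (H y)).
      all: now rewrite pr1_join, pr2_join in *.
Qed.

(** The leading quantifiers of the two predicates are merged into one over a pair, at every level of
    the prefix. *)
Lemma Cls_and k : forall b R R',
  Cls b k R -> Cls b k R' -> Cls b k (fun x => R x /\ R' x).
Proof.
  induction k; intros b R R' HR HR'; cbn in *.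
  - exact (DR_and _ _ HR HR').
  - destruct HR as [Q [HQ HR]], HR' as [Q' [HQ' HR']].
    exists (fun z => Q (join (pr1 z) (pr1 (pr2 z))) /\ Q' (join (pr1 z) (pr2 (pr2 z)))).
    split.
    + apply IHk.
      * apply (Cls_sub k _ Q (fun z => join (pr1 z) (pr1 (pr2 z))) HQ); definable.
      * apply (Cls_sub k _ Q' (fun z => join (pr1 z) (pr2 (pr2 z))) HQ'); definable.
    + intro x; rewrite HR, HR'; destruct b; split.
      * intros [[y H] [y' H']]; exists (join y y'); now rewrite !pr1_join, !pr2_join, pr1_join.
      * intros [y [H H']]; rewrite !pr1_join, !pr2_join in *; split; eexists; eauto.
      * intros [H H'] y; rewrite !pr1_join, !pr2_join; auto.
      * intro H; split; intro y.
        -- specialize (H (join y y)); rewrite !pr1_join, !pr2_join, pr1_join in H; apply H.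
        -- specialize (H (join y y)); rewrite !pr1_join, !pr2_join in H; apply H.
Qed.

Lemma Cls_not k : forall b R, Cls (negb b) k R -> Cls b k (fun x => ~ R x).
Proof.
  induction k; intros b R HR; cbn in *.
  - exact (Ar_not R HR).
  - destruct HR as [Q [HQ HR]]; exists (fun z => ~ Q z); split; [now apply IHk|].
    intro x; rewrite HR; destruct b; cbn; split.
    + apply not_all_ex_not.
    + intros [y H] H'; auto.
    + intros H y H'; eauto.
    + intros H [y H']; exact (H y H').
Qed.

Lemma Cls_or k b R R' :
  Cls b k R -> Cls b k R' -> Cls b k (fun x => R x \/ R' x).
Proof.
  intros H H'; eapply Cls_ext with (R := fun x => ~ (~ R x /\ ~ R' x)).
  - intro x; tauto.
  - apply Cls_not, Cls_and; apply Cls_not; now destruct b.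
Qed.

Lemma Cls_imp k b R R' :
  Cls (negb b) k R -> Cls b k R' -> Cls b k (fun x => R x -> R' x).
Proof.
  intros H H'; eapply Cls_ext with (R := fun x => ~ R x \/ R' x).
  - intro x; tauto.
  - apply Cls_or; [now apply Cls_not | assumption].
Qed.

Lemma functional_choice (A B : Type) (P : A -> B -> Prop) :
  (forall a, exists b, P a b) -> exists f, forall a, P a (f a).
Proof.
  intro H; exists (fun a => proj1_sig (constructive_indefinite_description _ (H a))).
  intro a; apply proj2_sig.
Qed.

(* Absorbing a number quantifier into the prefix takes countable choice:
   [forall i, exists y] becomes [exists Y, forall i] with [y = slice Y i]. *)
Lemma Cls_all_join k : forall b R, Cls b k R ->
  Cls b k (fun x => forall i, R (join x (num i))).
Proof.
  induction k; intros b R HR.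
  - cbn in *; eapply Ar_ext; [|exact (Ar_not _ (Ar_ex _ (Ar_not _ HR)))].
    intro x; cbn; split.
    + intros H i; apply NNPP; intro H'; apply H; eauto.
    + intros H [i H']; auto.
  - destruct HR as [Q [HQ HR]].
    exists (fun w => forall i, Q (join (join (pr1 w) (num i)) (slice (pr2 w) i))); split.
    + eapply Cls_ext; [|apply (IHk _ (fun v =>
        Q (join (join (pr1 (pr1 v)) (num (pr2 v 0)))
                (slice (pr2 (pr1 v)) (pr2 v 0)))))].
      * intro x; cbn; split; intros H i; specialize (H i);
          now rewrite !pr1_join, !pr2_join in *.
      * apply (Cls_sub k _ Q (fun v => join (join (pr1 (pr1 v)) (num (pr2 v 0)))
                (slice (pr2 (pr1 v)) (pr2 v 0))) HQ); definable.
    + intro x; destruct b; split.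
      * intro H.
        assert (H' : forall i, exists y, Q (join (join x (num i)) y))
          by (intro i; apply HR, H).
        apply functional_choice in H' as [f Hf].
        exists (fun k => f (pi1 k) (pi2 k)); intro i.
        rewrite pr1_join, pr2_join, slice_join; apply Hf.
      * intros [y H] i; apply HR; exists (slice y i); specialize (H i).
        now rewrite pr1_join, pr2_join in H.
      * intros H y i; rewrite pr1_join, pr2_join; now apply HR.
      * intros H i; apply HR; intro y.
        (* The sequence all of whose slices are [y] supplies [y] at the index [i]. *)
        specialize (H (fun k => (fun _ => y) (pi1 k) (pi2 k)) i).
        now rewrite pr1_join, pr2_join, (slice_join (fun _ => y)) in H.
Qed.

Lemma Cls_all b k (R : baire -> nat -> Prop) :
  Cls b k (fun z => R (pr1 z) (pr2 z 0)) -> Cls b k (fun x => forall i, R x i).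
Proof.
  intro H; eapply Cls_ext; [|exact (Cls_all_join k b _ H)].
  intro x; cbn; split; intros H' i; specialize (H' i);
    now rewrite pr1_join, pr2_join in *.
Qed.

Lemma Cls_ex b k (R : baire -> nat -> Prop) :
  Cls b k (fun z => R (pr1 z) (pr2 z 0)) -> Cls b k (fun x => exists i, R x i).
Proof.
  intro H; apply Cls_ext with (R := fun x => ~ forall i, ~ R x i).
  - intro x; split.
    + intro H'; apply not_all_ex_not in H' as [i H']; exists i; tauto.
    + intros [i H'] H''; exact (H'' i H').
  - apply Cls_not, Cls_all, Cls_not; now destruct b.
Qed.

(** Two adjacent quantifiers of the same kind contract to one over a pair. *)
Lemma Cls_quant_fun b k (R : baire -> baire -> Prop) :
  Cls b (S k) (fun z => R (pr1 z) (pr2 z)) ->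
  Cls b (S k) (fun x => if b then exists y, R x y else forall y, R x y).
Proof.
  intros [Q [HQ HR]].
  assert (E : forall x y, R x y <-> if b then exists w, Q (join (join x y) w)
                                  else forall w, Q (join (join x y) w)).
  { intros x y; rewrite <- HR; now rewrite pr1_join, pr2_join. }
  exists (fun z => Q (join (join (pr1 z) (pr1 (pr2 z))) (pr2 (pr2 z)))); split.
  - apply (Cls_sub k _ Q (fun z => join (join (pr1 z) (pr1 (pr2 z))) (pr2 (pr2 z))) HQ);
      definable.
  - intro x; destruct b; split.
    + intros [y H]; apply E in H as [w H]; exists (join y w).
      now rewrite pr1_join, !pr2_join, pr1_join.
    + intros [w H]; rewrite pr1_join, !pr2_join in H; exists (pr1 w); apply E; eauto.
    + intros H w; rewrite pr1_join, !pr2_join; now apply E.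
    + intros H y; apply E; intro w; specialize (H (join y w)).
      now rewrite pr1_join, !pr2_join, pr1_join in H.
Qed.

(** A vacuous quantifier is put in front. What follows it must lie in the dual class, except at
    level 0, where the two classes coincide. *)
Lemma Cls_dummy b b' k R : Cls b k R -> (b' = negb b \/ k = 0) -> Cls b' (S k) R.
Proof.
  intros H Hb; exists (fun z => R (pr1 z)); split.
  - apply (Cls_sub k _ R pr1); [|definable].
    destruct Hb as [->| ->]; [now destruct b | exact H].
  - intro x; destruct b'; split.
    + intro; exists x; now rewrite pr1_join.
    + intros [y H']; now rewrite pr1_join in H'.
    + intros H' y; now rewrite pr1_join.
    + intro H'; specialize (H' x); now rewrite pr1_join in H'.
Qed.

(** Here the vacuous quantifier is inserted at the innermost place, so the leading quantifier keeps
    its kind. *)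
Lemma Cls_same k : forall b R, Cls b k R -> Cls b (S k) R.
Proof.
  induction k; intros b R H.
  - apply (Cls_dummy b b 0 R H); auto.
  - destruct H as [Q [HQ HR]]; exists Q; auto.
Qed.

Lemma Cls_le b k k' R : k <= k' -> Cls b k R -> Cls b k' R.
Proof. induction 1; auto using Cls_same. Qed.

Lemma Cls_lt b b' k k' R : k < k' -> Cls b k R -> Cls b' k' R.
Proof.
  intros Hk H; destruct (Bool.bool_dec b b') as [<-|Hb].
  - apply (Cls_le b k); [lia | exact H].
  - apply (Cls_le b' (S k)); [lia|]; apply (Cls_dummy b); [exact H|].
    left; destruct b, b'; cbn; congruence.
Qed.

Lemma Cls_eq b k N M : NF N -> NF M -> Cls b k (fun x => N x = M x).
Proof.
  intros HN HM.
  apply (Cls_le b 0); [lia|]; exact (DR_eq _ _ HN HM).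
Qed.

(** * Delta^1_1 predicates and definition by recursion *)

(* Delta^1_1. *)
Definition Del (R : baire -> Prop) : Prop := forall b, Cls b 1 R.

Lemma Del_Cls R G b k : Del R -> Op G -> Cls b (S k) (fun x => R (G x)).
Proof. intros H HG; apply (Cls_le b 1); [lia|]; now apply Cls_sub. Qed.

(* A predicate is coded by a function [Z] with [Z j = 0] for "true"; by induction
   along [mu] the recursion [Phi] has [P x] as its only solution, so that [P x k]
   says both that some solution and that every solution vanishes at [k]. *)
Lemma Del_rec (P : baire -> nat -> Prop) (Phi : baire -> (nat -> Prop) -> nat -> Prop)
    (mu : nat -> nat) :
  (forall x k, P x k <-> Phi x (P x) k) ->
  (forall x Q Q' k, (forall j, mu j < mu k -> Q j -> Q' j) -> Phi x Q k -> Phi x Q' k) ->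
  Del (fun z => Phi (pr1 z) (fun j => pr1 (pr2 z) j = 0) (pr2 (pr2 z) 0)) ->
  forall b k G N, Op G -> NF N -> Cls b (S k) (fun x => P (G x) (N x)).
Proof.
  intros Hfix Hloc HPhi b k G N HG HN.
  (* The equivalence is split into two implications, the form to which closure under conjunction and
     implication applies. *)
  set (good := fun x (Z : baire) => forall k, (Z k = 0 -> Phi x (fun j => Z j = 0) k) /\
                                        (Phi x (fun j => Z j = 0) k -> Z k = 0)).
  assert (Huniq : forall x Z, good x Z -> forall k, Z k = 0 <-> P x k).
  { intros x Z HZ.
    (* Locality is phrased as monotonicity, so it is used once in each direction, with agreement
       below [mu k] as the induction hypothesis. *)
    assert (H : forall n k, mu k < n -> (Z k = 0 <-> P x k)).
    { induction n; intros j Hj; [lia|].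
      rewrite Hfix; split.
      - intro E; apply HZ in E; revert E; apply Hloc; intros i Hi; apply IHn; lia.
      - intro E; apply HZ; revert E; apply Hloc; intros i Hi; apply IHn; lia. }
    intro j; apply (H (S (mu j))); lia. }
  assert (Hex : forall x, exists Z, good x Z).
  { intro x.
    exists (fun j => if excluded_middle_informative (P x j) then 0 else 1).
    assert (E : forall j, (if excluded_middle_informative (P x j) then 0 else 1) = 0 <-> P x j).
    { intro j; destruct excluded_middle_informative; split; intro; congruence || tauto. }
    intro j; rewrite E, Hfix; split; apply Hloc; intros i _; apply E. }
  assert (Hgood : forall b, Cls b 1 (fun z => good (pr1 (pr1 z)) (pr2 z))).
  { intro b'; apply Cls_all.
    apply Cls_and; apply Cls_imp; try (apply Cls_eq; definable).
    all: eapply Cls_ext; [|apply (Cls_sub 1 _ _ (fun z => join (pr1 (pr1 (pr1 z)))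
         (join (pr2 (pr1 z)) (num (pr2 z 0)))) (HPhi _)); definable].
    all: intro z; cbn; now rewrite !pr2_join, !pr1_join. }
  assert (HP : Del (fun z => P (pr1 z) (pr2 z 0))).
  { intros [].
    - eapply Cls_ext; [|apply (Cls_quant_fun true 0
        (fun z Z => good (pr1 z) Z /\ Z (pr2 z 0) = 0))].
      + intro z; cbn; split.
        * intros [Z [HZ E]]; now apply (Huniq _ _ HZ).
        * intro H; destruct (Hex (pr1 z)) as [Z HZ]; exists Z; split; [exact HZ|].
          now apply (Huniq _ _ HZ).
      + apply Cls_and; [apply Hgood | apply Cls_eq; definable].
    - eapply Cls_ext; [|apply (Cls_quant_fun false 0
        (fun z Z => good (pr1 z) Z -> Z (pr2 z 0) = 0))].
      + intro z; cbn; split.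
        * intro H; destruct (Hex (pr1 z)) as [Z HZ]; apply (Huniq _ _ HZ); auto.
        * intros H Z HZ; now apply (Huniq _ _ HZ).
      + apply Cls_imp; [apply Hgood | apply Cls_eq; definable]. }
  eapply Cls_ext; [|apply (Del_Cls _ (fun x => join (G x) (num (N x))) b k HP); definable].
  intro x; cbn; now rewrite pr1_join, pr2_join.
Qed.

Lemma Cls_app b k (R : baire -> nat -> Prop) G N :
  Cls b k (fun z => R (pr1 z) (pr2 z 0)) -> Op G -> NF N ->
  Cls b k (fun x => R (G x) (N x)).
Proof.
  intros H HG HN.
  eapply Cls_ext; [|apply (Cls_sub k b _ (fun x => join (G x) (num (N x))) H); definable].
  intro x; cbn; now rewrite pr1_join, pr2_join.
Qed.

Ltac cls :=
  cbv beta;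
  lazymatch goal with
  | |- Cls _ _ (fun x => _ /\ _) => apply Cls_and; cls
  | |- Cls _ _ (fun x => _ \/ _) => apply Cls_or; cls
  | |- Cls _ _ (fun x => ~ _) => apply Cls_not; cls
  | |- Cls _ _ (fun x => exists i : nat, _) => apply Cls_ex; cls
  | |- Cls _ _ (fun x => forall i : nat, _) => apply Cls_all; cls
  | |- Cls _ _ (fun x => _ -> _) => apply Cls_imp; cls
  | |- Cls _ _ (fun x => @eq nat _ _) => first [now eauto with cls | apply Cls_eq; definable]
  | |- _ => solve [eauto with cls]
  end.

(** * Recursive relations *)

Lemma eval_PRec_0 f g a v : eval (PRec f g) (cpair a 0) v <-> eval f a v.
Proof.
  cbn; rewrite pi1_cpair, pi2_cpair; split.
  - intros [h [H [_ ->]]]; exact H.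
  - intro H; exists (fun _ => v); repeat split; auto; lia.
Qed.

(** The history function in [eval] is traded for a relation between consecutive values, which is the
    shape that [Del_rec] accepts. *)
Lemma eval_PRec_S f g a j v :
  eval (PRec f g) (cpair a (S j)) v <->
  exists w, eval (PRec f g) (cpair a j) w /\ eval g (cpair a (cpair j w)) v.
Proof.
  cbn; rewrite !pi1_cpair, !pi2_cpair; split.
  - intros [h [H [H' ->]]]; exists (h j); split; [exists h; repeat split|]; auto with arith.
  - intros [w [[h [H [H' ->]]] Hv]].
    (* The old history is kept up to [j]; every later entry is [v]. *)
    exists (fun i => if i <=? j then h i else v); cbv beta; repeat split; auto.
    + intros i Hi.
      destruct (Nat.leb_spec i j); [|lia]; destruct (Nat.leb_spec (S i) j); [auto with arith|].
      now replace i with j by lia.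
    + now destruct (Nat.leb_spec (S j) j); [lia|].
Qed.

(** Induction on the program. Since [b] is arbitrary, the bound is Delta^1_1; only primitive
    recursion needs [Del_rec]. *)
Lemma Cls_eval c : forall b k N M,
  NF N -> NF M -> Cls b (S k) (fun x => eval c (N x) (M x)).
Proof.
  induction c; intros b k N M HN HM; cbn [eval].
  1-4: apply Cls_eq; definable.
  - apply Cls_ex, Cls_ex, Cls_and; [apply IHc1; definable|].
    apply Cls_and; [apply IHc2; definable | apply Cls_eq; definable].
  - apply Cls_ex, Cls_and; [apply IHc2; definable | apply IHc1; definable].
  (* The number [t] codes [cpair (cpair a i) v]: parameter, counter and value. The counter is the
     measure. *)
  - eapply Cls_ext; [|apply (Del_rec
      (fun _ t => eval (PRec c1 c2) (pi1 t) (pi2 t))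
      (fun _ Q t => exists a i v, t = cpair (cpair a i) v /\
        ((i = 0 /\ eval c1 a v) \/
         exists j w, i = S j /\ Q (cpair (cpair a j) w) /\ eval c2 (cpair a (cpair j w)) v))
      (fun t => pi2 (pi1 t))) with (G := fun x => x) (N := fun x => cpair (N x) (M x))].
    + intro x; cbv beta; now rewrite pi1_cpair, pi2_cpair.
    + intros _ t; split.
      * intro H; exists (pi1 (pi1 t)), (pi2 (pi1 t)), (pi2 t); split; [now rewrite !cpair_pi|].
        rewrite <- (cpair_pi (pi1 t)) in H.
        destruct (pi2 (pi1 t)) as [|j]; [left; split; [reflexivity|]; now apply eval_PRec_0 in H|].
        right; apply eval_PRec_S in H as [w [H H']]; exists j, w.
        now rewrite pi1_cpair, pi2_cpair.
      * intros (a & i & v & -> & [[-> H]|(j & w & -> & H & H')]);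
          rewrite !pi1_cpair, !pi2_cpair in *.
        -- now apply eval_PRec_0.
        -- apply eval_PRec_S; eauto.
    + intros _ Q Q' t HQ (a & i & v & -> & H); exists a, i, v; split; [reflexivity|].
      destruct H as [H|(j & w & -> & H & H')]; [now left|right].
      exists j, w; repeat split; auto; apply HQ; [|exact H].
      rewrite !pi1_cpair, !pi2_cpair; lia.
    + intro b'; do 3 apply Cls_ex; apply Cls_and; [apply Cls_eq; definable|].
      apply Cls_or; [apply Cls_and; [apply Cls_eq; definable | apply IHc1; definable]|].
      do 2 apply Cls_ex; apply Cls_and; [apply Cls_eq; definable|].
      apply Cls_and; [apply Cls_eq; definable | apply IHc2; definable].
    + apply Op_id.
    + definable.
  - apply Cls_and; [apply IHc; definable|].
    (* The bound [i < M x] is rewritten as a solvable equation, since atomic conditions are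
       equalities. *)
    eapply Cls_ext with (R := fun x => forall i, (exists d, i + S d = M x) ->
      exists u, eval c (cpair (N x) i) (S u)).
    + intro x; split; intros H i Hi; apply H; [exists (M x - S i); lia | destruct Hi; lia].
    + apply Cls_all, Cls_imp; [apply Cls_ex, Cls_eq; definable|].
      apply Cls_ex, IHc; definable.
Qed.

(** Recursion on the bit position: bit 0 of [u] is its parity, and bit [S j] of [u] is bit [j] of
    its half [w]. *)
Lemma Cls_D b k N M : NF N -> NF M -> Cls b (S k) (fun x => D (N x) (M x)).
Proof.
  intros HN HM.
  eapply Cls_ext; [|apply (Del_rec
    (fun _ t => D (pi1 t) (pi2 t))
    (fun _ Q t => exists u i w, t = cpair u i /\
      ((i = 0 /\ u = 2 * w + 1) \/
       exists j, i = S j /\ (u = 2 * w \/ u = 2 * w + 1) /\ Q (cpair w j)))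
    pi2) with (G := fun x => x) (N := fun x => cpair (N x) (M x))].
  - intro x; cbv beta; now rewrite pi1_cpair, pi2_cpair.
  - intros _ t; unfold D; split.
    + intro H; exists (pi1 t), (pi2 t), (Nat.div2 (pi1 t)); split; [now rewrite cpair_pi|].
      destruct (pi2 t) as [|j].
      * left; split; [reflexivity|].
        rewrite Nat.bit0_odd in H; pose proof (Nat.div2_odd (pi1 t)) as E.
        rewrite H in E; exact E.
      * right; exists j; rewrite pi1_cpair, pi2_cpair, Nat.div2_spec, Nat.shiftr_spec' .
        repeat split; [|now rewrite Nat.add_1_r].
        rewrite <- Nat.div2_spec.
        pose proof (Nat.div2_odd (pi1 t)) as E; destruct (Nat.odd (pi1 t)); cbn in E; lia.
    + intros (u & i & w & -> & [[-> ->]|(j & -> & E & H)]);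
        rewrite pi1_cpair, pi2_cpair in *.
      * apply Nat.testbit_odd_0.
      * destruct E as [-> | ->]; [now rewrite Nat.testbit_even_succ by lia|].
        now rewrite Nat.testbit_odd_succ by lia.
  - intros _ Q Q' t HQ (u & i & w & -> & H); exists u, i, w; split; [reflexivity|].
    destruct H as [H|(j & -> & E & H)]; [now left|right].
    exists j; repeat split; auto; apply HQ; [|exact H].
    rewrite !pi2_cpair; lia.
  - intro; cls.
  - apply Op_id.
  - definable.
Qed.

Fixpoint numeral (n : nat) : term :=
  match n with 0 => TZero | S n => TSucc (numeral n) end.

Lemma ftval_numeral rho s n : ftval rho s (numeral n) = n.
Proof. induction n; cbn; congruence. Qed.

Lemma tval_numeral rho env n : tval rho env (numeral n) = n.
Proof. rewrite tval_ftval; apply ftval_numeral. Qed.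

(** Formulas containing numerals can thereby be described through their codes inside a predicate, as
    the diagonal argument requires. *)
Lemma Cls_numeral b k N M :
  NF N -> NF M -> Cls b (S k) (fun x => tcode (numeral (N x)) = M x).
Proof.
  intros HN HM.
  eapply Cls_ext; [|apply (Del_rec
    (fun _ t => tcode (numeral (pi1 t)) = pi2 t)
    (fun _ Q t => t = cpair 0 (cpair 1 0) \/
       exists n v, t = cpair (S n) (cpair 2 v) /\ Q (cpair n v))
    pi1) with (G := fun x => x) (N := fun x => cpair (N x) (M x))].
  - intro x; cbv beta; now rewrite pi1_cpair, pi2_cpair.
  - intros _ t; split.
    + intro H; rewrite <- (cpair_pi t), <- H; destruct (pi1 t) as [|n]; [now left|right].
      exists n, (tcode (numeral n)); now rewrite pi1_cpair, pi2_cpair.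
    + intros [-> | (n & v & -> & H)]; rewrite !pi1_cpair, !pi2_cpair in *; [reflexivity|].
      cbn; now rewrite H.
  - intros _ Q Q' t HQ [-> | (n & v & -> & H)]; [now left|right].
    exists n, v; split; [reflexivity|]; apply HQ; [|exact H]; rewrite !pi1_cpair; lia.
  - intro; cls.
  - apply Op_id.
  - definable.
Qed.

(** * Truth definitions *)

(* [join (join (num e) x_1 ... ) x_l] codes the number [e] and the list
   [x_l; ...; x_1]. *)
Fixpoint stack_list (l : nat) (z : baire) : list baire :=
  match l with 0 => nil | S l => pr2 z :: stack_list l (pr1 z) end.

Fixpoint stack_num (l : nat) (z : baire) : nat :=
  match l with 0 => z 0 | S l => stack_num l (pr1 z) end.

(** The length [l] is fixed, so a finite case distinction on the variable index [F x] suffices, and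
    the bound holds at every level, including 0. *)
Lemma Cls_stack_list l : forall b k G F N V, Op G -> NF F -> NF N -> NF V ->
  Cls b k (fun x => flist (stack_list l (G x)) (F x) (N x) = V x).
Proof.
  induction l; intros b k G F N V HG HF HN HV; cbn [stack_list].
  - eapply Cls_ext; [|apply (Cls_eq b k (fun _ => 0) V); definable].
    intro x; unfold flist; now destruct (F x).
  - eapply Cls_ext with (R := fun x => (F x = 0 /\ pr2 (G x) (N x) = V x) \/
      exists f, F x = S f /\ flist (stack_list l (pr1 (G x))) f (N x) = V x).
    + intro x; unfold flist; destruct (F x) as [|f]; cbn; split.
      * intros [[_ H]|[f [E _]]]; [exact H | discriminate].
      * auto.
      * intros [[E _]|[f' [E H]]]; [discriminate | now injection E as ->].
      * right; eauto.
    + apply Cls_or; [apply Cls_and; apply Cls_eq; definable|].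
      apply Cls_ex, Cls_and; [apply Cls_eq; definable|].
      apply (IHl b k (fun z => pr1 (G (pr1 z)))); definable.
Qed.

#[local] Hint Extern 0 (Cls _ _ (fun x => flist _ _ _ = _)) =>
  apply Cls_stack_list; definable : cls.

Lemma NF_stack_num l : forall G, Op G -> NF (fun x => stack_num l (G x)).
Proof.
  induction l; intros G HG; cbn.
  - apply (NF_app G (fun _ => 0)); definable.
  - apply (IHl (fun x => pr1 (G x))); definable.
Qed.

(** A number codes an environment by iterated pairing: [cpair a c] pushes [a], and 0, being the pair
    of 0 and 0, codes the empty environment. *)
Fixpoint lookup (i c : nat) : nat :=
  match i with 0 => pi1 c | S i => lookup i (pi2 c) end.

Definition env (c : nat) : nat -> nat := fun i => lookup i c.

Lemma env_cpair a c : env (cpair a c) = scons a (env c).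
Proof.
  apply functional_extensionality; intros []; cbn; [apply pi1_cpair|].
  now rewrite pi2_cpair.
Qed.

Lemma env_0 : env 0 = nlist nil.
Proof.
  apply functional_extensionality; intro i; unfold nlist.
  transitivity 0; [|now destruct i].
  unfold env; induction i; [reflexivity | exact IHi].
Qed.

Definition Val (l : nat) (x : baire) (k c v : nat) : Prop :=
  exists t, tcode t = k /\ ftval (flist (stack_list l x)) (env c) t = v.

(** Tarski's clauses for terms. The variable clause removes one entry of the environment at a time,
    so that looking up an entry is part of the same recursion. *)
Lemma Val_rec l x k c v : Val l x k c v <->
  (k = cpair 0 0 /\ v = pi1 c) \/
  (exists i, k = cpair 0 (S i) /\ Val l x (cpair 0 i) (pi2 c) v) \/
  (k = cpair 1 0 /\ v = 0) \/
  (exists r w, k = cpair 2 r /\ v = S w /\ Val l x r c w) \/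
  (exists r r' w w', k = cpair 3 (cpair r r') /\ v = w + w' /\
     Val l x r c w /\ Val l x r' c w') \/
  (exists r r' w w', k = cpair 4 (cpair r r') /\ v = w * w' /\
     Val l x r c w /\ Val l x r' c w') \/
  (exists f r w, k = cpair 5 (cpair f r) /\ Val l x r c w /\
     flist (stack_list l x) f w = v).
Proof.
  split.
  - intros [t [<- <-]].
    destruct t as [[|i]| |t|t t'|t t'|f t]; cbn [tcode ftval].
    + now left.
    + right; left; exists i; split; [reflexivity|]; now exists (TVar i).
    + do 2 right; now left.
    + do 3 right; left; do 2 eexists; repeat split; eexists; eauto.
    + do 4 right; left; do 4 eexists; repeat split; eexists; eauto.
    + do 5 right; left; do 4 eexists; repeat split; eexists; eauto.
    + do 6 right; do 3 eexists; split; [reflexivity|]; split; [eexists; eauto|]; auto.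
  - intros [[-> ->]|[(i & -> & t & Et & <-)|[[-> ->]|[(r & w & -> & -> & t & <- & <-)|
      [(r & r' & w & w' & -> & -> & (t & <- & <-) & t' & <- & <-)|
      [(r & r' & w & w' & -> & -> & (t & <- & <-) & t' & <- & <-)|
       (f & r & w & -> & (t & <- & <-) & <-)]]]]]].
    + now exists (TVar 0).
    + exists (TVar (S i)); split; [reflexivity|].
      apply (tcode_inj t (TVar i)) in Et as ->; reflexivity.
    + now exists TZero.
    + now exists (TSucc t).
    + now exists (TAdd t t').
    + now exists (TMul t t').
    + now exists (TApp f t).
Qed.

Lemma Cls_Val l b k G N C V : Op G -> NF N -> NF C -> NF V ->
  Cls b (S k) (fun x => Val l (G x) (N x) (C x) (V x)).
Proof.
  intros HG HN HC HV.
  eapply Cls_ext; [|apply (Del_rec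
    (fun x t => Val l x (pi1 t) (pi1 (pi2 t)) (pi2 (pi2 t)))
    (fun x Q t => exists k c v, t = cpair k (cpair c v) /\
      ((k = cpair 0 0 /\ v = pi1 c) \/
      (exists i, k = cpair 0 (S i) /\ Q (cpair (cpair 0 i) (cpair (pi2 c) v))) \/
      (k = cpair 1 0 /\ v = 0) \/
      (exists r w, k = cpair 2 r /\ v = S w /\ Q (cpair r (cpair c w))) \/
      (exists r r' w w', k = cpair 3 (cpair r r') /\ v = w + w' /\
         Q (cpair r (cpair c w)) /\ Q (cpair r' (cpair c w'))) \/
      (exists r r' w w', k = cpair 4 (cpair r r') /\ v = w * w' /\
         Q (cpair r (cpair c w)) /\ Q (cpair r' (cpair c w'))) \/
      (exists f r w, k = cpair 5 (cpair f r) /\ Q (cpair r (cpair c w)) /\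
         flist (stack_list l x) f w = v)))
    pi1) with (G := G) (N := fun x => cpair (N x) (cpair (C x) (V x)))].
  - intro x; cbv beta; now rewrite pi1_cpair, !pi2_cpair, pi1_cpair.
  - assert (E : forall x k c v, Val l x k c v <-> Val l x (pi1 (cpair k (cpair c v)))
      (pi1 (pi2 (cpair k (cpair c v)))) (pi2 (pi2 (cpair k (cpair c v)))))
      by (intros; now rewrite pi1_cpair, !pi2_cpair, pi1_cpair).
    intros x t; split.
    + intro H; exists (pi1 t), (pi1 (pi2 t)), (pi2 (pi2 t)); split; [now rewrite !cpair_pi|].
      setoid_rewrite <- E; now apply Val_rec.
    + intros (k' & c & v & -> & H); setoid_rewrite <- E in H.
      rewrite <- E; now apply Val_rec.
  - intros x Q Q' t HQ (k' & c & v & -> & H); exists k', c, v; split; [reflexivity|].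
    rewrite pi1_cpair in HQ.
    (* Only the code has to decrease; environment and value are unconstrained. *)
    assert (HQ' : forall j d, j < k' -> Q (cpair j d) -> Q' (cpair j d))
      by (intros j d Hj; apply HQ; now rewrite pi1_cpair).
    destruct H as [H|[(i & -> & H)|[H|[(r & w & -> & H & H')|
      [(r & r' & w & w' & -> & H & H' & H'')|
      [(r & r' & w & w' & -> & H & H' & H'')|
       (f & r & w & -> & H & H')]]]]]].
    + now left.
    + right; left; exists i; split; [reflexivity|]; apply HQ'; [|exact H].
      apply cpair_lt_mono_r; lia.
    + do 2 right; now left.
    + do 3 right; left; exists r, w; repeat split; auto; apply HQ'; [|exact H'].
      apply cpair_lt_r.
    + do 4 right; left; exists r, r', w, w'; repeat split; auto; apply HQ'; auto; apply cpair_lt_pair.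
    + do 5 right; left; exists r, r', w, w'; repeat split; auto; apply HQ'; auto; apply cpair_lt_pair.
    + do 6 right; exists f, r, w; repeat split; auto; apply HQ'; auto; apply cpair_lt_pair.
  - intro; cls.
  - exact HG.
  - definable.
Qed.

#[local] Hint Extern 0 (Cls _ _ (fun x => Val _ _ _ _ _)) => apply Cls_Val; definable : cls.

(* The truth value [b] is a parameter because negation must not apply to numbers
   that code no formula. *)
Definition Tru (l : nat) (x : baire) (k c b : nat) : Prop :=
  exists p, fcode p = k /\
    let P := fsat (flist (stack_list l x)) (env c) p in (b = 1 /\ P) \/ (b = 0 /\ ~ P).

(** With truth values as arguments every clause is positive in [Tru], as the monotonicity in
    [Del_rec] demands: negation reads [b + b' = 1], conjunction is a product, and a false
    existential is a universal statement about the value 0. *)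
Lemma Tru_rec l x k c b : Tru l x k c b <->
  (exists r r' v v', k = cpair 0 (cpair r r') /\ Val l x r c v /\ Val l x r' c v' /\
     ((b = 1 /\ v = v') \/ (b = 0 /\ ~ v = v'))) \/
  (exists r b', k = cpair 1 r /\ b + b' = 1 /\ Tru l x r c b') \/
  (exists r r' b' b'', k = cpair 2 (cpair r r') /\ b = b' * b'' /\
     Tru l x r c b' /\ Tru l x r' c b'') \/
  (exists r, k = cpair 3 r /\
     ((b = 1 /\ exists a, Tru l x r (cpair a c) 1) \/
      (b = 0 /\ forall a, Tru l x r (cpair a c) 0))).
Proof.
  assert (T : forall p c, exists b, Tru l x (fcode p) c b /\
      ((b = 1 /\ fsat (flist (stack_list l x)) (env c) p) \/
       (b = 0 /\ ~ fsat (flist (stack_list l x)) (env c) p))).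
  { intros p d; destruct (classic (fsat (flist (stack_list l x)) (env d) p)).
    - exists 1; split; [exists p|]; auto.
    - exists 0; split; [exists p|]; auto. }
  split.
  - intros [p [<- H]]; cbv zeta in H.
    destruct p as [t t'|p|p q|p]; cbn [fcode fsat] in *.
    + left; do 4 eexists; repeat split; try (eexists; eauto); exact H.
    + right; left; destruct (T p c) as [b' [Hb' H']].
      exists (fcode p), b'; repeat split; auto.
      destruct H as [[-> H]|[-> H]], H' as [[-> H']|[-> H']]; tauto.
    + do 2 right; left; destruct (T p c) as [b1 [Hb1 H1]], (T q c) as [b2 [Hb2 H2]].
      exists (fcode p), (fcode q), b1, b2; repeat split; auto.
      destruct H as [[-> H]|[-> H]], H1 as [[-> H1]|[-> H1]], H2 as [[-> H2]|[-> H2]];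
        cbn; tauto.
    + do 3 right; exists (fcode p); split; [reflexivity|].
      destruct H as [[-> [a H]]|[-> H]].
      * left; split; [reflexivity|]; exists a, p; rewrite env_cpair; auto.
      * right; split; [reflexivity|]; intro a; exists p; rewrite env_cpair; split; [reflexivity|].
        right; split; [reflexivity|]; eauto.
  - intros [(r & r' & v & v' & -> & (t & <- & <-) & (t' & <- & <-) & H)|
      [(r & b' & -> & E & p & <- & H)|
       [(r & r' & b1 & b2 & -> & -> & (p & <- & H) & q & <- & H')|
        (r & -> & [[-> [a [p [<- H]]]]|[-> H]])]]].
    + exists (FEq t t'); auto.
    + exists (FNot p); split; [reflexivity|]; cbv zeta in *; cbn.
      destruct H as [[-> H]|[-> H]]; [right|left]; split; auto; lia.
    + exists (FAnd p q); split; [reflexivity|]; cbv zeta in *; cbn.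
      destruct H as [[-> H]|[-> H]], H' as [[-> H']|[-> H']]; cbn; tauto.
    + exists (FEx p); split; [reflexivity|]; cbv zeta in *; cbn.
      left; split; [reflexivity|]; exists a; rewrite <- env_cpair.
      destruct H as [[_ H]|[? _]]; [exact H | discriminate].
    (* The instance 0 only serves to obtain the formula; injectivity of [fcode] shows that every
       other instance concerns the same one. *)
    + destruct (H 0) as [p [<- _]]; exists (FEx p); split; [reflexivity|].
      right; split; [reflexivity|]; cbn; intros [a Ha].
      destruct (H a) as [q [E [[? _]|[_ H']]]]; [discriminate|].
      apply fcode_inj in E as ->; apply H'; now rewrite env_cpair.
Qed.

Lemma Cls_Tru l b k G N C V : Op G -> NF N -> NF C -> NF V ->
  Cls b (S k) (fun x => Tru l (G x) (N x) (C x) (V x)).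
Proof.
  intros HG HN HC HV.
  eapply Cls_ext; [|apply (Del_rec
    (fun x t => Tru l x (pi1 t) (pi1 (pi2 t)) (pi2 (pi2 t)))
    (fun x Q t => exists k c b, t = cpair k (cpair c b) /\
      ((exists r r' v v', k = cpair 0 (cpair r r') /\ Val l x r c v /\ Val l x r' c v' /\
         ((b = 1 /\ v = v') \/ (b = 0 /\ ~ v = v'))) \/
      (exists r b', k = cpair 1 r /\ b + b' = 1 /\ Q (cpair r (cpair c b'))) \/
      (exists r r' b' b'', k = cpair 2 (cpair r r') /\ b = b' * b'' /\
         Q (cpair r (cpair c b')) /\ Q (cpair r' (cpair c b''))) \/
      (exists r, k = cpair 3 r /\
         ((b = 1 /\ exists a, Q (cpair r (cpair (cpair a c) 1))) \/
          (b = 0 /\ forall a, Q (cpair r (cpair (cpair a c) 0)))))))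
    pi1) with (G := G) (N := fun x => cpair (N x) (cpair (C x) (V x)))].
  - intro x; cbv beta; now rewrite pi1_cpair, !pi2_cpair, pi1_cpair.
  - assert (E : forall x k c v, Tru l x k c v <-> Tru l x (pi1 (cpair k (cpair c v)))
      (pi1 (pi2 (cpair k (cpair c v)))) (pi2 (pi2 (cpair k (cpair c v)))))
      by (intros; now rewrite pi1_cpair, !pi2_cpair, pi1_cpair).
    intros x t; split.
    + intro H; exists (pi1 t), (pi1 (pi2 t)), (pi2 (pi2 t)); split; [now rewrite !cpair_pi|].
      setoid_rewrite <- E; now apply Tru_rec.
    + intros (k' & c & v & -> & H); setoid_rewrite <- E in H.
      rewrite <- E; now apply Tru_rec.
  - intros x Q Q' t HQ (k' & c & v & -> & H); exists k', c, v; split; [reflexivity|].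
    rewrite pi1_cpair in HQ.
    assert (HQ' : forall j d, j < k' -> Q (cpair j d) -> Q' (cpair j d))
      by (intros j d Hj; apply HQ; now rewrite pi1_cpair).
    destruct H as [H|[(r & b' & -> & H & H')|[(r & r' & b1 & b2 & -> & H & H' & H'')|
      (r & -> & [[E [a H]]|[E H]])]]].
    + now left.
    + right; left; exists r, b'; repeat split; auto; apply HQ'; auto using cpair_lt_r.
    + do 2 right; left; exists r, r', b1, b2; repeat split; auto; apply HQ'; auto;
        apply cpair_lt_pair.
    + do 3 right; exists r; split; [reflexivity|]; left; split; [exact E|].
      exists a; apply HQ'; auto using cpair_lt_r.
    + do 3 right; exists r; split; [reflexivity|]; right; split; [exact E|].
      intro a; apply HQ'; auto using cpair_lt_r.
  - intro; cls.
  - exact HG.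
  - definable.
Qed.

(** The universal predicate for prefixes of length [k], with the code of the matrix and its [l]
    function arguments packed into [z]. *)
Definition Sat (b : bool) (k l : nat) (z : baire) : Prop :=
  exists p, fcode p = stack_num l z /\ prenex b k p (stack_list l z).

Lemma Del_Sat_0 b l : Del (Sat b 0 l).
Proof.
  intro b'.
  eapply Cls_ext; [|apply (Cls_Tru l b' 0 (fun z => z) (stack_num l) (fun _ => 0) (fun _ => 1))].
  - intro z; split.
    + intros [p [E [[_ H]|[? _]]]]; [|discriminate]; exists p; split; [exact E|].
      apply sat_fsat; now rewrite <- env_0.
    + intros [p [E H]]; exists p; split; [exact E|]; left; split; [reflexivity|].
      apply sat_fsat in H; now rewrite env_0.
  - definable.
  - apply (NF_stack_num l (fun z => z)), Op_id.
  - definable.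
  - definable.
Qed.

Lemma Sat_S b k l z :
  Sat b (S k) l z <-> if b then exists y, Sat false k (S l) (join z y)
                    else forall y, Sat true k (S l) (join z y).
Proof.
  unfold Sat; cbn [stack_num stack_list prenex]; destruct b; split.
  - intros [p [E [y H]]]; exists y, p; now rewrite pr1_join, pr2_join.
  - intros [y [p [E H]]]; rewrite pr1_join, pr2_join in *; exists p; eauto.
  - intros [p [E H]] y; exists p; now rewrite pr1_join, pr2_join.
  (* One instance fixes the formula [p]; the other instances have the same code, hence the same
     formula. *)
  - intro H; destruct (H zero) as [p [E _]]; rewrite pr1_join in E; exists p; split; [exact E|].
    intro y; destruct (H y) as [q [E' H']]; rewrite pr1_join, pr2_join in *.
    rewrite <- E in E'; now apply fcode_inj in E' as ->.
Qed.

(** Truth of matrices is only known to be Delta^1_1, so its own function quantifier is chosen of the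
    same kind as the innermost quantifier of the prefix and contracted with it. *)
Lemma Cls_Sat k : forall b l, Cls b (S k) (Sat b (S k) l).
Proof.
  induction k; intros b l.
  - eapply Cls_ext; [|apply (Cls_quant_fun b 0 (fun z y => Sat (negb b) 0 (S l) (join z y)))].
    + intro z; symmetry; destruct b; apply Sat_S.
    + eapply Cls_ext; [|exact (Del_Sat_0 (negb b) (S l) b)].
      intro z; cbn; now rewrite join_pr.
  - exists (Sat (negb b) (S k) (S l)); split; [apply IHk|].
    intro z; destruct b; apply Sat_S.
Qed.

(** The strict inequality gives the Pi bound: a lower level lies in both classes of level [k]. For
    [n = 0] this uses that truth of matrices is Delta^1_1. *)
Lemma Cls_nbhd_filter n k (H : n < k) :
  Cls false k (fun z => nbhd_filter n (pr1 z) (pr2 z 0)) /\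
  Cls true k (fun z => nbhd_filter k (pr1 z) (pr2 z 0)).
Proof.
  assert (E : forall n z, Sat true n 1 (join (pr2 z) (pr1 z)) <->
                          nbhd_filter n (pr1 z) (pr2 z 0)).
  { intros n' z; unfold Sat, nbhd_filter, Sigma1; cbn [stack_num stack_list].
    now rewrite pr1_join, pr2_join. }
  assert (G : Op (fun z => join (pr2 z) (pr1 z))) by definable.
  destruct k as [|k]; [lia|]; split; (eapply Cls_ext; [apply E|]).
  - apply (Cls_sub _ _ (Sat true n 1) _); [|exact G]; destruct n as [|n].
    + apply (Cls_le false 1); [lia|]; apply Del_Sat_0.
    + apply (Cls_lt true _ (S n)); [lia|]; apply Cls_Sat.
  - apply (Cls_sub _ _ (Sat true (S k) 1) _); [apply Cls_Sat | exact G].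
Qed.

(** * Normal form and diagonalization *)

(* Binds variable 0 of [q] to [n]; the code of [pin n q] depends on [q] only
   through its code. *)
Definition pin (n : nat) (q : form) : form := FEx (FAnd (FEq (TVar 0) (numeral n)) q).

(** Packs a number and a list of functions in the format that [stack_num] and [stack_list] read. *)
Fixpoint stack (rho : list baire) (n : nat) : baire :=
  match rho with nil => num n | y :: rho => join (stack rho n) y end.

(** The same packing from a total environment, starting at function variable [i], where it is
    arithmetically definable. *)
Fixpoint stackf (l i : nat) (rho : nat -> baire) (n : nat) : baire :=
  match l with 0 => num n | S l => join (stackf l (S i) rho n) (rho i) end.

Lemma stackf_stack rho n r : forall i, (forall j, r (i + j) = flist rho j) ->
  stackf (length rho) i r n = stack rho n.
Proof.
  induction rho as [|y rho IH]; intros i H; cbn; [reflexivity|].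
  rewrite IH.
  - specialize (H 0); rewrite Nat.add_0_r in H; now rewrite H.
  - intro j; specialize (H (S j)); rewrite Nat.add_succ_r in H; exact H.
Qed.

Lemma DF_stackf l : forall i, DF (fun rho s => stackf l i rho (s 1) (s 0)).
Proof.
  induction l; intro i; cbn; [apply DF_var|].
  apply DF_cpair; [apply IHl | apply DF_app, DF_var].
Qed.

(** Normal form: each predicate of the class is given by a prenex formula. The matrix [q] is chosen
    before [n], so [n] may later be the code of [q] itself. *)
Lemma prenex_pin k : forall b R, Cls b k R -> forall l, exists q, forall rho n,
  length rho = l -> (prenex b k (pin n q) rho <-> R (stack rho n)).
Proof.
  induction k; intros b R HR l; cbn in HR.
  - destruct (Ar_sub R (fun rho s => stackf l 0 rho (s 0)) HR (DF_stackf l 0)) as [q Hq].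
    exists q; intros rho n Hl; cbn [prenex].
    rewrite sat_fsat; cbn [fsat pin].
    rewrite <- (stackf_stack rho n (flist rho) 0) by reflexivity; rewrite Hl.
    split.
    + intros [a [E H]]; apply Hq in H; cbn in *; now rewrite E, ftval_numeral in H.
    + intro H; exists n; split; [now rewrite ftval_numeral|]; now apply Hq.
  - destruct HR as [Q [HQ HR]]; destruct (IHk _ _ HQ (S l)) as [q Hq].
    exists q; intros rho n Hl; rewrite HR; cbn [prenex].
    assert (E : forall y, prenex (negb b) k (pin n q) (y :: rho) <-> Q (join (stack rho n) y))
      by (intro y; apply Hq; cbn; now rewrite Hl).
    destruct b; cbn in E; split.
    + intros [y H]; exists y; now apply E.
    + intros [y H]; exists y; now apply E.
    + intros H y; now apply E.
    + intros H y; now apply E.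
Qed.

(** * Enumeration operators and the contradiction *)

Definition enum (Phi B : natset) : natset :=
  fun k => exists e, Phi (cpair k e) /\ forall i, D e i -> B i.

(** An enumeration operator adds only number quantifiers and Delta^1_1 conditions, and [B] occurs
    positively, so both classes of a positive level are preserved. *)
Lemma Cls_enum Phi b k (B : baire -> natset) : ce Phi ->
  Cls b (S k) (fun z => B (pr1 z) (pr2 z 0)) ->
  Cls b (S k) (fun z => enum Phi (B (pr1 z)) (pr2 z 0)).
Proof.
  intros [c Hc] HB; apply Cls_ex; cbv beta; apply Cls_and.
  - eapply Cls_ext; [intro; symmetry; apply Hc|].
    apply Cls_ex, Cls_eval; definable.
  - apply Cls_all, Cls_imp; [apply Cls_D; definable|].
    apply (Cls_app b _ B (fun z => pr1 (pr1 (pr1 z)))); [exact HB | definable | definable].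
Qed.

(** The [n] prefix quantifiers push their functions in front of the point, which therefore is
    function variable [n] of the matrix. *)
Definition graph_form (n i j : nat) : form := FEq (TApp n (numeral i)) (numeral j).

Lemma nbhd_filter_graph_form n x i j :
  nbhd_filter n x (fcode (graph_form n i j)) <-> x i = j.
Proof.
  (* The prefix is vacuous here: the function at index [f] moves to index [k + f] while [k] others
     are pushed. *)
  assert (H : forall k b rho f,
    prenex b k (graph_form (k + f) i j) rho <-> nth f rho zero i = j).
  { induction k; intros b rho f.
    - cbn; now rewrite !tval_numeral.
    - replace (S k + f) with (k + S f) by lia; cbn [prenex].
      destruct b; split.
      + intros [y H]; now apply IHk in H.
      + intro H; exists zero; now apply IHk.
      + intro H; now apply (IHk true (zero :: rho) (S f)).
      + intros H y; now apply IHk. }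
  specialize (H n true (x :: nil) 0); rewrite Nat.add_0_r in H; cbn in H.
  rewrite <- H; split.
  - intros [p [E Hp]]; now apply fcode_inj in E as ->.
  - intro Hp; now exists (graph_form n i j).
Qed.

Lemma enum_ext Phi B B' k : (forall i, B i <-> B' i) -> enum Phi B k <-> enum Phi B' k.
Proof.
  intro H; split; intros [e [He HB]]; exists e; split; auto; intros i Hi; apply H, HB, Hi.
Qed.

Lemma nbhd_filters_not_equiv n m x y (A : natset) : n < m ->
  equiv_e (nbhd_filter n x) A -> equiv_e (nbhd_filter m y) A -> False.
Proof.
  intros Hnm [[P1 [c1 H1]] [P2 [c2 H2]]] [[P3 [c3 H3]] [P4 [c4 H4]]].
  assert (Hx : forall k, nbhd_filter n x k <-> enum P1 (enum P4 (nbhd_filter m y)) k)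
    by (intro k; rewrite H1; apply enum_ext, H4).
  assert (Hy : forall k, nbhd_filter m y k <-> enum P3 (enum P2 (nbhd_filter n x)) k)
    by (intro k; rewrite H3; apply enum_ext, H2).
  destruct (Cls_nbhd_filter n m Hnm) as [Cn Cm].
  destruct m as [|m]; [lia|].
  (* [Cn] becomes a Pi bound and [Cm] a Sigma bound for the composed operators, both at level
     [S m]. *)
  apply (Cls_enum P2 _ _ _ c2), (Cls_enum P3 _ _ (fun x' => enum P2 (nbhd_filter n x')) c3) in Cn.
  apply (Cls_enum P4 _ _ _ c4), (Cls_enum P1 _ _ (fun y' => enum P4 (nbhd_filter (S m) y')) c1) in Cm.
  (* The first code is that of [graph_form n i (x' i)], so for [pr2 z = y] the first conjunct says
     that [x'] is [x]. The second code is that of [pin e q] when [e = pr1 z 0] is the code of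
     [q]. *)
  set (R := fun z => exists x',
    (forall i u v, tcode (numeral i) = u -> tcode (numeral (x' i)) = v ->
       enum P1 (enum P4 (nbhd_filter (S m) (pr2 z)))
         (cpair 0 (cpair (cpair 5 (cpair n u)) v))) /\
    (exists u, tcode (numeral (pr1 z 0)) = u /\
       ~ enum P3 (enum P2 (nbhd_filter n x'))
           (cpair 3 (cpair 2 (cpair (cpair 0 (cpair (cpair 0 0) u)) (pr1 z 0)))))).
  assert (HR : Cls true (S m) R).
  { apply (Cls_quant_fun true m); apply Cls_and.
    - do 3 apply Cls_all.
      do 2 (apply Cls_imp; [apply Cls_numeral; definable|]).
      apply (Cls_app _ _ (fun y => enum P1 (enum P4 (nbhd_filter (S m) y)))
               (fun z => pr2 (pr1 (pr1 (pr1 (pr1 z)))))); [exact Cm | definable | definable].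
    - apply Cls_ex, Cls_and; [apply Cls_numeral; definable|].
      (* Negation turns the Pi bound [Cn] into the Sigma bound required of [R]. *)
      apply Cls_not.
      apply (Cls_app _ _ (fun x' => enum P3 (enum P2 (nbhd_filter n x')))
               (fun z => pr2 (pr1 z))); [exact Cn | definable | definable]. }
  assert (HRy : forall q, R (join (num (fcode q)) y) <->
                          ~ nbhd_filter (S m) y (fcode (pin (fcode q) q))).
  { intro q; unfold R; rewrite pr1_join, pr2_join, Hy; split.
    - intros [x' [Hx' [u [<- H]]]].
      replace x with x'; [exact H|].
      apply functional_extensionality; intro i; symmetry.
      apply (nbhd_filter_graph_form n); rewrite Hx; exact (Hx' i _ _ eq_refl eq_refl).
    - intro H; exists x; split; [|eauto].
      intros i u v <- <-; rewrite <- Hx; now apply (nbhd_filter_graph_form n x i (x i)). }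
  (* Diagonalization: the matrix [q] obtained for [R] is evaluated at its own code. *)
  destruct (prenex_pin (S m) true R HR 1) as [q Hq].
  specialize (Hq (y :: nil) (fcode q) eq_refl); cbn [stack] in Hq.
  rewrite HRy in Hq.
  assert (E : nbhd_filter (S m) y (fcode (pin (fcode q) q)) <->
              prenex true (S m) (pin (fcode q) q) (y :: nil)).
  { split; [|now exists (pin (fcode q) q)].
    intros [p [E H]]; now apply fcode_inj in E as ->. }
  (* The formula with matrix [pin (fcode q) q] would hold of [y] exactly if it did not. *)
  tauto.
Qed.

Theorem theorem7p54 (n m : nat) (hnm : n <> m) :
  ~ exists d : natset -> Prop, e_degree d /\ GH_degree n d /\ GH_degree m d.
Proof.
  intros [d [[A HA] [[_ [x Hx]] [_ [y Hy]]]]].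
  apply HA in Hx, Hy.
  destruct (Nat.lt_total n m) as [H|[H|H]]; [|contradiction|];
    eapply nbhd_filters_not_equiv; eauto.
Qed.
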